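(* $Ps$-normality is an additive property: if $(X_\alpha)_{\alpha\in\Lambda}$ is a family of $Ps$-normal topological spaces, then the topological sum (disjoint union) $\bigoplus_{\alpha\in\Lambda}X_\alpha$ is $Ps$-normal.
   Context: A topological space is normal if any two disjoint closed subsets are contained in disjoint open sets (no $T_1$ assumption). A topological space is pseudocompact if every real-valued continuous function on it is bounded; a subset is called pseudocompact if it is pseudocompact in the subspace topology. A space $X$ is $Ps$-normal if there exist a normal space $Y$ and a bijection $f:X\to Y$ such that $f|_K:K\to f(K)$ is a homeomorphism (subspace topologies) for every pseudocompact subset $K$ of $X$. *)

(* Defs.v *)
From mathcomp Require Import all_boot all_order all_algebra.
From mathcomp Require Import all_classical all_reals all_analysis.
Import numFieldNormedType.Exports.

Set Implicit Arguments.
Unset Strict Implicit.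
Unset Printing Implicit Defensive.

Local Open Scope classical_set_scope.
Local Open Scope ring_scope.

Definition homeomorphism (X Y : topologicalType) (f : X -> Y) : Prop :=
  exists g : Y -> X,
    [/\ cancel f g, cancel g f, continuous f & continuous g].

(* The real line is any [realType]; all of them are isomorphic. *)
Definition pseudocompact_space (R : realType) (X : topologicalType) : Prop :=
  forall f : X -> R, continuous f -> bounded_fun f.

(* [set_type K] carries the subspace topology, i.e. the initial topology of the
   inclusion; [subspace K] would not do, its underlying type being all of X. *)
Definition pseudocompact (R : realType) (X : topologicalType) (K : set X)
    : Prop :=
  pseudocompact_space R (set_type K).

(* The map K -> f @` K induced by f. *)
Definition restriction (X Y : Type) (f : X -> Y) (K : set X)
    : set_type K -> set_type (f @` K) :=
  sigLR [fun f in K].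
Arguments restriction {X Y} f K _.

(* [normal_space] includes no T1 axiom; [normal_openP] is its formulation in
   terms of disjoint closed sets and disjoint open sets. *)
Definition Ps_normal (R : realType) (X : topologicalType) : Prop :=
  exists (Y : topologicalType) (f : X -> Y),
    [/\ normal_space Y, bijective f &
        forall K : set X, pseudocompact R K ->
          homeomorphism (restriction f K)].

(* Main.v *)
(* The sum of the witnessing normal spaces, with the sum of the bijections,
   witnesses the theorem. Each trace of a pseudocompact K on a summand is
   pseudocompact, and continuity on K (or of the inverse on the image of K) is
   checked summand by summand, each summand being open. *)

Require Import Defs.
From mathcomp Require Import all_boot all_order all_algebra.
From mathcomp Require Import all_classical all_reals all_analysis.
Import numFieldNormedType.Exports.

Set Implicit Arguments.
Unset Strict Implicit.
Unset Printing Implicit Defensive.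

Local Open Scope classical_set_scope.
Local Open Scope ring_scope.

Lemma continuous_set_type (X Y : topologicalType) (K : set Y)
    (h : X -> set_type K) :
  continuous h <-> continuous (set_val \o h).
Proof.
split=> [ch x|]; last exact: continuous_comp_initial.
by apply: continuous_comp; [exact: ch|exact: initial_continuous].
Qed.

(** Replaces maps between subtypes by the total maps [f] and [g], whose continuity within a set can
    be checked summand by summand. *)
Lemma homeomorphism_restrictionP (X Y : topologicalType) (f : X -> Y)
    (g : Y -> X) (K : set X) : cancel f g -> cancel g f ->
  homeomorphism (restriction f K) <->
  {within K, continuous f} /\ {within f @` K, continuous g}.
Proof.
move=> fK gK.
have fE : set_val \o restriction f K = sigL K f by [].
have gP (y : set_type (f @` K)) : g (set_val y) \in K.
  by case: y => z /= zK; rewrite inE set_valE /=; case: (set_mem zK) => x Kx <-; rewrite fK.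
pose h y : set_type K := SigSub (gP y).
have hE : set_val \o h = sigL (f @` K) g by [].
have fh : cancel (restriction f K) h.
  by move=> x; apply: val_inj; exact: fK.
have hf : cancel h (restriction f K).
  by move=> y; apply: val_inj; exact: gK.
split=> [[k [fk kf cf ck]]|[/subspace_sigL_continuousP cf
                            /subspace_sigL_continuousP cg]].
  (* The continuous inverse [k] is abstract; uniqueness of inverses identifies it with the
     corestriction [h] of [g]. *)
  have kh : h = k by apply/funext => y; rewrite -[in LHS](kf y) fh.
  split; apply/subspace_sigL_continuousP.
    by rewrite -fE; apply/continuous_set_type.
  by rewrite -hE kh; apply/continuous_set_type.
by exists h; split=> //; apply/continuous_set_type.
Qed.

Lemma pseudocompactP (R : realType) (X : topologicalType) (K : set X) :
  pseudocompact R K <->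
  forall h : X -> R, {within K, continuous h} -> [bounded h x | x in K].
Proof.
split=> [pK h /subspace_sigL_continuousP /pK|pK h ch].
  rewrite /bounded_near; apply: filterS => M hM x Kx.
  by have := hM (SigSub (mem_set Kx)) I.
(* The value 0 given outside [K] is arbitrary: continuity within [K] and boundedness on [K] ignore
   it. *)
have /pK : {within K, continuous (valL_ 0 h)}.
  exact/subspace_valL_continuousP'.
rewrite -[in bounded_fun _](@valLK _ _ 0 K h) /bounded_near.
by apply: filterS => M hM x _; exact: hM (set_valP x).
Qed.

Section topological_sum.
Context {I : choiceType}.
Implicit Types X Y : I -> topologicalType.

(** A neighbourhood of a point of the sum is, by definition, a set whose trace on the summand of
    that point is a neighbourhood, so the two limit conditions coincide. *)
Lemma within_sigT_continuousP X (Z : topologicalType) (K : set {i & X i})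
    (h : {i & X i} -> Z) :
  {within K, continuous h} <->
  forall i, {within existT X i @^-1` K, continuous (h \o existT X i)}.
Proof.
split=> [/subspace_continuousP ch i|ch].
  by apply/subspace_continuousP => x Kx; exact: (ch (existT X i x)).
apply/subspace_continuousP => -[i x] Kx.
by have /subspace_continuousP := ch i; exact.
Qed.

Lemma within_tagged_map_continuous X Y (f : forall i, X i -> Y i)
    (K : set {i & X i}) :
  (forall i, {within existT X i @^-1` K, continuous (f i)}) ->
  {within K, continuous (fun u => existT Y (tag u) (f _ (tagged u)))}.
Proof.
move=> cf; apply/within_sigT_continuousP => i.
apply: (@within_continuous_comp _ _ _ _ (f i) (existT Y i)) => // y _.
exact: existT_continuous.
Qed.

Lemma sigT_closed_preimage X (i : I) (A : set {i & X i}) :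
  closed A -> closed (existT X i @^-1` A).
Proof. by move=> cA; apply: closed_comp => // x _; exact: existT_continuous. Qed.

(** The traces of [A] and [B] on each summand are closed and disjoint; the open sets separating
    them, chosen for each index, are glued together. *)
Lemma sigT_normal_space (R : realType) X :
  (forall i, normal_space (X i)) -> normal_space {i & X i}.
Proof.
move=> nX; apply/(@normal_openP R) => A B cA cB AB.
have sep i : exists UV : set (X i) * set (X i),
    [/\ open UV.1, open UV.2, existT X i @^-1` A `<=` UV.1,
        existT X i @^-1` B `<=` UV.2 & UV.1 `&` UV.2 = set0].
  have /(@normal_openP R) := nX i.
  move=> /(_ _ _ (sigT_closed_preimage cA) (sigT_closed_preimage cB)).
  rewrite -preimage_setI AB preimage_set0 => /(_ erefl) [U [V UV]].
  by exists (U, V).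
pose W i := projT1 (cid (sep i)); have WP i := projT2 (cid (sep i)).
exists [set u | (W (tag u)).1 (tagged u)], [set u | (W (tag u)).2 (tagged u)].
split.
- by apply/sigT_openP => i; case: (WP i).
- by apply/sigT_openP => i; case: (WP i).
- by move=> [i x] Ax; case: (WP i) => _ _ AW _ _; exact: AW.
- by move=> [i x] Bx; case: (WP i) => _ _ _ BW _; exact: BW.
- rewrite -subset0 => -[i x] /= Wx; case: (WP i) => _ _ _ _ W0.
  by rewrite -[False]/(set0 x) -W0.
Qed.

(* A function on one summand extends by zero to the whole sum. *)
Lemma pseudocompact_sigT_preimage (R : realType) X (K : set {i & X i}) (i : I) :
  pseudocompact R K -> pseudocompact R (existT X i @^-1` K).
Proof.
move=> /pseudocompactP pK; apply/pseudocompactP => h ch.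
have hE x : untag 0 h (existT X i x) = h x by rewrite untagE.
have /pK : {within K, continuous (untag 0 h)}.
  (* The extension restricts to [h] on summand [i] and to the constant 0 on every other. *)
  apply/within_sigT_continuousP => j; have [<-|ji] := eqVneq i j.
    by rewrite (_ : _ \o _ = h)//; apply/funext.
  rewrite (_ : _ \o _ = cst 0).
    exact/continuous_subspaceT/cst_continuous.
  by apply/funext => x /=; rewrite untag_dflt//= eq_sym.
by rewrite /bounded_near; apply: filterS => M hM x Kx; rewrite /= -hE; exact: hM.
Qed.

End topological_sum.

Theorem theorem2p8 (R : realType) (Lambda : choiceType)
    (X : Lambda -> topologicalType)
    (hX : forall alpha : Lambda, Ps_normal R (X alpha)) :
  Ps_normal R {alpha : Lambda & X alpha}.
Proof.
have [Y hY] := choice hX.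
have fgP i : exists fg : (X i -> Y i) * (Y i -> X i),
    [/\ cancel fg.1 fg.2, cancel fg.2 fg.1 & forall K : set (X i),
      pseudocompact R K -> homeomorphism (restriction fg.1 K)].
  by have [f [_ [g fK gK] fP]] := hY i; exists (f, g).
(* Both maps come from one chosen pair, so that they are inverse to each other. *)
pose f i := (projT1 (cid (fgP i))).1; pose g i := (projT1 (cid (fgP i))).2.
have fK i : cancel (f i) (g i) by rewrite /f /g; case: cid => ? [].
have gK i : cancel (g i) (f i) by rewrite /f /g; case: cid => ? [].
have fP i (K : set (X i)) :
    pseudocompact R K -> homeomorphism (restriction (f i) K).
  by rewrite /f; case: cid => ? [? ? +] /=; exact.
pose F (u : {i & X i}) := existT Y (tag u) (f _ (tagged u)).
pose G (v : {i & Y i}) := existT X (tag v) (g _ (tagged v)).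
have FK : cancel F G by move=> [i x]; rewrite /F /G /= fK.
have GK : cancel G F by move=> [i y]; rewrite /F /G /= gK.
exists {i & Y i}, F; split.
- by apply: (sigT_normal_space R) => i; have [? []] := hY i.
- by exists G.
move=> K pK; apply/(homeomorphism_restrictionP _ FK GK).
have fgK i : {within existT X i @^-1` K, continuous (f i)} /\
             {within f i @` (existT X i @^-1` K), continuous (g i)}.
  apply/(homeomorphism_restrictionP _ (fK i) (gK i)).
  exact/fP/pseudocompact_sigT_preimage.
split; apply: within_tagged_map_continuous => i; first by case: (fgK i).
have [_] := fgK i; apply: continuous_subspaceW => y [[j x] Kx] Fxy.
(* Applying [G] to [Fxy] puts [g i y] in the trace of [K] without inverting an equality of dependent
   pairs. *)
have KG : K (G (existT Y i y)) by rewrite -Fxy FK.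
exists (g i y); [exact: KG|exact: gK].
Qed.
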